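(* Let $k \ge 1$ and $\theta = 2\pi/(4k+4)$. For every $\varepsilon > 0$ there exist a finite point set $P$ in general position and $u, w \in P$ such that the shortest path between $u$ and $w$ in the $\theta_{4k+4}$-graph on $P$ has length at least $(1 + 2\tan(\theta/2) + 2\tan^2(\theta/2) - \varepsilon)|uw|$. That is, the worst-case spanning ratio of $\theta_{4k+4}$-graphs is at least $1 + 2\tan(\theta/2) + 2\tan^2(\theta/2)$.
   Context: Cones: for $m \ge 2$, $\theta = 2\pi/m$; around each point $u$ draw $m$ rays with consecutive angular separation $\theta$, oriented so the vertical upward ray from $u$ bisects a cone $C_0^u$; cones numbered clockwise, same orientation at every point. General position: no two points on a line parallel to a cone boundary ray, no two on a line perpendicular to a cone bisector, no three collinear. The $\theta_m$-graph on $P$: for each $u\in P$ and each cone $C_i^u$ containing another point of $P$, add an edge from $u$ to the point of $C_i^u$ whose orthogonal projection onto the bisector of $C_i^u$ is closest to $u$; edges weighted by Euclidean length. *)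

(* Defs.v *)
From Stdlib Require Import Reals Lra List.
Open Scope R_scope.

Definition point : Type := (R * R)%type.

Definition dot (a b : point) : R := fst a * fst b + snd a * snd b.
Definition cross (a b : point) : R := fst a * snd b - snd a * fst b.
Definition vsub (a b : point) : point := (fst a - fst b, snd a - snd b).
Definition edist (a b : point) : R :=
  sqrt ((fst a - fst b) ^ 2 + (snd a - snd b) ^ 2).

Definition theta (m : nat) : R := 2 * PI / INR m.

Definition dir (a : R) : point := (cos a, sin a).

(* Bisector of cone C_i: cone 0 is bisected by the upward vertical ray
   (angle pi/2); cones are numbered clockwise, so the bisector of C_i
   has angle pi/2 - i*theta. *)
Definition bisector (m i : nat) : point := dir (PI / 2 - INR i * theta m).

Definition boundary_ray (m j : nat) : point :=
  dir (PI / 2 - theta m / 2 - INR j * theta m).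

(* v lies in cone C_i^u : v <> u and the angle between v - u and the
   bisector of C_i is at most theta/2. *)
Definition in_cone (m i : nat) (u v : point) : Prop :=
  v <> u /\
  dot (vsub v u) (bisector m i) >= edist v u * cos (theta m / 2).

Definition proj (m i : nat) (u v : point) : R := dot (vsub v u) (bisector m i).

Definition general_position (m : nat) (P : list point) : Prop :=
  (forall p q, In p P -> In q P -> p <> q ->
     forall j, (j < m)%nat -> cross (vsub q p) (boundary_ray m j) <> 0) /\
  (forall p q, In p P -> In q P -> p <> q ->
     forall i, (i < m)%nat -> dot (vsub q p) (bisector m i) <> 0) /\
  (forall p q r, In p P -> In q P -> In r P -> p <> q -> p <> r -> q <> r ->
     cross (vsub q p) (vsub r p) <> 0).

Definition theta_edge (m : nat) (P : list point) (u v : point) : Prop :=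
  In u P /\ In v P /\
  exists i, (i < m)%nat /\ in_cone m i u v /\
    forall x, In x P -> in_cone m i u x -> proj m i u v <= proj m i u x.

Definition theta_adj (m : nat) (P : list point) (u v : point) : Prop :=
  theta_edge m P u v \/ theta_edge m P v u.

Inductive theta_path (m : nat) (P : list point) : point -> point -> R -> Prop :=
| tp_nil : forall u, theta_path m P u u 0
| tp_cons : forall u v w L,
    theta_adj m P u v -> theta_path m P v w L ->
    theta_path m P u w (edist u v + L).

(* Main.v *)
(** With m = 4k + 4 the bisectors of four cones are the coordinate axes.  Put
    t = tan (theta / 2) <= 1/2 and scale so that u = (0, 0), w = (t, 1).  The edge uw
    is blocked by the far corner A0 = (-t, 1) of the canonical triangle of w seen
    from u; A0 and w are kept apart by W2, directly above w on the boundary of the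
    east cone of A0; W2 and w are kept apart by W1, on the boundary of the south
    cone of W2.  Then |u A0| = |uw|, |A0 W2| = 2 t |uw| and
    |W2 W1| + |W1 w| = 2 t^2 |uw|.  To lengthen all paths at once, the configuration
    is completed by the mirror images A1, A2 of W1, W2 in the vertical axis, and by
    the images of all points under the central symmetry exchanging u and w.

    Path lengths are bounded below by a potential [pot], essentially the graph
    distance from u: it is 1-Lipschitz on all pairs of sites except those whose edge
    is blocked.  The ideal configuration has points on cone boundaries, so it is
    first shifted by multiples of a small h to make every blocking relation hold
    with margin h, and then perturbed generically, point by point, to avoid the
    finitely many lines excluded by general position.  Both steps cost only an
    arbitrarily small factor in the potential. *)

Require Import Defs.
From Stdlib Require Import Reals List Lra Lia.
Import ListNotations.
Open Scope R_scope.

(** * Generic perturbation of a finite family into general position *)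

Definition near (e : R) (q p : point) : Prop :=
  (fst q - e < fst p < fst q + e) /\ (snd q - e < snd p < snd q + e).

Lemma near_le (e e' : R) (q p : point) : e' <= e -> near e' q p -> near e q p.
Proof. unfold near; lra. Qed.

(** A whole neighbourhood of [p], not just [p], must avoid the lines: the induction then dodges the
    next line inside that neighbourhood and keeps all earlier conditions. *)
Lemma avoid_lines (ls : list (point * point)) (q : point) (e : R) :
  0 < e ->
  exists (p : point) (e' : R), 0 < e' /\
    forall x, near e' p x -> near e q x /\
      forall a d, In (a, d) ls -> d <> (0, 0) -> cross (vsub x a) d <> 0.
Proof.
intros He; induction ls as [|[a d] ls IH].
- exists q, e; split; [easy|]; intros x Hx; split; [easy|]; intros ? ? [].
- destruct IH as (p & e1 & He1 & Hp).
  assert (Hdec : d = (0, 0) \/ d <> (0, 0)).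
  { destruct d as [d1 d2].
    destruct (Req_dec d1 0), (Req_dec d2 0); subst; auto;
      right; intros E; injection E; intros; congruence. }
  destruct Hdec as [Hd|Hd].
  { exists p, e1; split; [easy|]; intros x Hx; split; [now apply Hp|].
    intros a' d' [E|Hin] Hd'; [congruence|]. now apply (Hp x Hx). }
  assert (Hp' : exists p', (forall r, r <= e1 / 2 -> forall x, near r p' x -> near e1 p x) /\
                           cross (vsub p' a) d <> 0).
  (* If [p] is on the new line, it is moved by [e1 / 2] parallel to a coordinate axis that is
     transversal to [d]. *)
  { destruct (Req_dec (cross (vsub p a) d) 0) as [Hz|Hz].
    - assert (Hd' : fst d <> 0 \/ snd d <> 0).
      { destruct d as [d1 d2]; simpl.
        destruct (Req_dec d1 0), (Req_dec d2 0); subst; auto. }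
      destruct Hd' as [Hd'|Hd'].
      + exists (fst p, snd p + e1 / 2); split.
        * intros r Hr x; unfold near; simpl; lra.
        * unfold cross, vsub in *; simpl in *; intros E.
          assert (E' : e1 / 2 * fst d = 0) by lra.
          apply Rmult_integral in E'; lra.
      + exists (fst p + e1 / 2, snd p); split.
        * intros r Hr x; unfold near; simpl; lra.
        * unfold cross, vsub in *; simpl in *; intros E.
          assert (E' : e1 / 2 * snd d = 0) by lra.
          apply Rmult_integral in E'; lra.
    - exists p; split; [|easy]. intros r Hr x; unfold near; lra. }
  destruct Hp' as (p' & Hin & Hp').
  set (g := Rabs (cross (vsub p' a) d)).
  assert (Hg : 0 < g) by now apply Rabs_pos_lt.
  (* Moving within [g / n] of [p'] changes the cross product by at most [g / n * (n - 1)], which is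
     less than [g], so it cannot reach 0. *)
  set (n := Rabs (fst d) + Rabs (snd d) + 1).
  assert (Hn : 0 < n).
  { unfold n; pose proof (Rabs_pos (fst d)); pose proof (Rabs_pos (snd d)); lra. }
  assert (Hgn : 0 < g / n) by now apply Rdiv_lt_0_compat.
  exists p', (Rmin (e1 / 2) (g / n)); split.
  { apply Rmin_glb_lt; lra. }
  intros x Hx.
  assert (Hx1 : near e1 p x) by (apply (Hin _ (Rmin_l (e1 / 2) (g / n))), Hx).
  split; [now apply Hp|].
  intros a' d' [E|Hin'] Hd'; [|now apply (Hp x Hx1)].
  injection E; intros; subst a' d'; clear E.
  assert (Hx2 : near (g / n) p' x) by (eapply near_le, Hx; apply Rmin_r).
  intros Hc.
  assert (Hdiff : cross (vsub p' a) d =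
    (fst p' - fst x) * snd d + (snd x - snd p') * fst d).
  { transitivity (cross (vsub p' a) d - cross (vsub x a) d);
      [rewrite Hc; ring | unfold cross, vsub; simpl; ring]. }
  assert (Hbound : g <= g / n * (Rabs (fst d) + Rabs (snd d))).
  { unfold g at 1; rewrite Hdiff.
    eapply Rle_trans; [apply Rabs_triang|]; rewrite !Rabs_mult.
    destruct Hx2 as [H1 H2].
    assert (Rabs (fst p' - fst x) <= g / n) by (apply Rabs_le; lra).
    assert (Rabs (snd x - snd p') <= g / n) by (apply Rabs_le; lra).
    pose proof (Rabs_pos (fst d)); pose proof (Rabs_pos (snd d)); nra. }
  assert (g = g / n * n) by (field; lra).
  unfold n in *; lra.
Qed.

Definition perp (b : point) : point := (- snd b, fst b).

Lemma dot_cross_perp (v b : point) : dot v b = cross v (perp b).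
Proof. unfold dot, cross, perp; simpl; ring. Qed.

Lemma dir_nonzero (a : R) : dir a <> (0, 0).
Proof.
unfold dir; intros E; injection E; intros H1 H2.
pose proof (sin2_cos2 a) as H; unfold Rsqr in H; rewrite H1, H2 in H; lra.
Qed.

Lemma perp_dir_nonzero (a : R) : perp (dir a) <> (0, 0).
Proof.
unfold perp, dir; simpl; intros E; injection E; intros H1 H2.
pose proof (sin2_cos2 a) as H; unfold Rsqr in H; rewrite H1 in H; nra.
Qed.

(** Each condition involving the new point keeps it off a line through an old point, directed along
    a boundary ray, perpendicular to a bisector, or towards another old point. These are finitely
    many lines. *)
Lemma general_position_extend (m : nat) (P : list point) (q : point) (e : R) :
  (0 < m)%nat -> 0 < e -> NoDup P -> general_position m P ->
  exists p, near e q p /\ NoDup (p :: P) /\ general_position m (p :: P).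
Proof.
intros Hm He HP (G1 & G2 & G3).
set (dirs := fun a => map (boundary_ray m) (seq 0 m)
  ++ map (fun i => perp (bisector m i)) (seq 0 m) ++ map (fun b => vsub b a) P).
destruct (avoid_lines (flat_map (fun a => map (pair a) (dirs a)) P) q e He)
  as (p & e' & He' & Hp).
destruct (Hp p) as [Hn Hl]; [unfold near; lra|]; clear Hp.
assert (Hav : forall a d, In a P -> In d (dirs a) -> d <> (0, 0) ->
                cross (vsub p a) d <> 0).
{ intros a d Ha Hd; apply Hl, in_flat_map; exists a; split; [easy|].
  now apply in_map. }
clear Hl.
assert (H1 : forall a j, In a P -> (j < m)%nat ->
               cross (vsub p a) (boundary_ray m j) <> 0).
{ intros a j Ha Hj; apply Hav; [easy| |apply dir_nonzero].
  apply in_or_app; left; apply in_map, in_seq; lia. }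
assert (H2 : forall a i, In a P -> (i < m)%nat -> dot (vsub p a) (bisector m i) <> 0).
{ intros a i Ha Hi; rewrite dot_cross_perp; apply Hav; [easy| |apply perp_dir_nonzero].
  apply in_or_app; right; apply in_or_app; left.
  apply (in_map (fun i => perp (bisector m i))), in_seq; lia. }
assert (H3 : forall a b, In a P -> In b P -> a <> b ->
               cross (vsub p a) (vsub b a) <> 0).
{ intros a b Ha Hb Hab; apply Hav; [easy| |].
  - apply in_or_app; right; apply in_or_app; right.
    now apply (in_map (fun b => vsub b a)).
  - intros E; apply Hab; destruct a, b; unfold vsub in E; simpl in E.
    injection E; intros; f_equal; lra. }
clear Hav.
assert (Hcr : forall x y z, cross (vsub x y) z = - cross (vsub y x) z)
  by (intros; unfold cross, vsub; simpl; ring).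
assert (Hdt : forall x y z, dot (vsub x y) z = - dot (vsub y x) z)
  by (intros; unfold dot, vsub; simpl; ring).
exists p; split; [easy|]; split; [|split; [|split]].
(* If [p] were an old point, its zero difference with itself would contradict [H1] for ray 0, which
   exists since [0 < m]. *)
- constructor; [|easy]. intros Hin; apply (H1 p 0%nat Hin Hm).
  unfold cross, vsub; simpl; ring.
- intros a b [<-|Ha] [<-|Hb] Hab j Hj; [easy| | |now apply G1].
  + rewrite Hcr; apply Ropp_neq_0_compat; auto.
  + auto.
- intros a b [<-|Ha] [<-|Hb] Hab j Hj; [easy| | |now apply G2].
  + rewrite Hdt; apply Ropp_neq_0_compat; auto.
  + auto.
- intros a b c [<-|Ha] [<-|Hb] [<-|Hc] Hab Hac Hbc; try easy; [| | |now apply G3].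
  + replace (cross _ _) with (- cross (vsub p b) (vsub c b))
      by (unfold cross, vsub; simpl; ring).
    apply Ropp_neq_0_compat; auto.
  + auto.
  + replace (cross _ _) with (- cross (vsub p a) (vsub b a))
      by (unfold cross, vsub; simpl; ring).
    apply Ropp_neq_0_compat; auto.
Qed.

Lemma general_position_approx (I : Type) (dec : forall x y : I, {x = y} + {x <> y})
    (m : nat) (S : list I) (q : I -> point) (e : R) :
  (0 < m)%nat -> 0 < e -> NoDup S ->
  exists p : I -> point, (forall x, In x S -> near e (q x) (p x)) /\
    NoDup (map p S) /\ general_position m (map p S).
Proof.
intros Hm He; induction 1 as [|x S Hx HS IH].
- exists q; repeat split; try constructor; intros; contradiction.
- destruct IH as (p & Hn & Hd & Hg).
  destruct (general_position_extend m (map p S) (q x) e Hm He Hd Hg)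
    as (px & Hnx & Hdx & Hgx).
  set (p' := fun y => if dec x y then px else p y).
  assert (E : map p' (x :: S) = px :: map p S).
  { simpl; f_equal; [unfold p'; now destruct (dec x x)|].
    apply map_ext_in; intros y Hy; unfold p'.
    destruct (dec x y) as [->|]; [contradiction|easy]. }
  exists p'; rewrite E; split; [|easy].
  intros y Hy; unfold p'; destruct (dec x y) as [<-|Hxy]; [easy|].
  destruct Hy as [|Hy]; [contradiction|auto].
Qed.

(** * Lower bounds on path length from a potential *)

Lemma NoDup_map_inj (A B : Type) (f : A -> B) (S : list A) (x y : A) :
  NoDup (map f S) -> In x S -> In y S -> f x = f y -> x = y.
Proof.
induction S as [|a S IH]; simpl; [easy|].
intros Hd [<-|Hx] [<-|Hy] E; inversion_clear Hd as [|? ? Ha HS]; auto;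
  exfalso; apply Ha; [rewrite E|rewrite <- E]; now apply in_map.
Qed.

Lemma edist_sym (u v : point) : edist u v = edist v u.
Proof. unfold edist; f_equal; ring. Qed.

(** The increments of [f] telescope along the path. The potential lives on labels, so it does not
    depend on the perturbed coordinates; injectivity of [p] on [S] makes this consistent. *)
Lemma path_length_ge_potential (I : Type) (m : nat) (S : list I) (p : I -> point)
    (f : I -> R) :
  NoDup (map p S) ->
  (forall x y, In x S -> In y S -> theta_edge m (map p S) (p x) (p y) ->
     Rabs (f x - f y) <= edist (p x) (p y)) ->
  forall u w L, theta_path m (map p S) u w L ->
  forall x y, In x S -> In y S -> u = p x -> w = p y -> f y - f x <= L.
Proof.
intros Hd Hf u w L HL; induction HL as [u|u v w L Huv HL IH]; intros x y Hx Hy Eu Ew.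
- assert (x = y) by (apply (NoDup_map_inj _ _ p S); congruence).
  subst y; lra.
- assert (Hv : In v (map p S)) by (destruct Huv as [H|H]; apply H).
  apply in_map_iff in Hv; destruct Hv as (z & <- & Hz).
  specialize (IH z y Hz Hy eq_refl Ew).
  assert (Hxz : Rabs (f z - f x) <= edist u (p z)).
  { subst u; destruct Huv as [H|H].
    - rewrite Rabs_minus_sym; auto.
    - rewrite edist_sym; auto. }
  pose proof (Rle_abs (f z - f x)); lra.
Qed.

(** * Cone membership through slopes, and blocked edges *)

Lemma theta_pos (m : nat) : (0 < m)%nat -> 0 < theta m.
Proof.
intros Hm; unfold theta; pose proof PI_RGT_0; pose proof (lt_0_INR m Hm).
apply Rdiv_lt_0_compat; lra.
Qed.

Lemma INR_theta (m : nat) : (0 < m)%nat -> INR m * theta m = 2 * PI.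
Proof. intros Hm; unfold theta; field; apply not_0_INR; lia. Qed.

Lemma cos_lt_away (a x : R) : 0 < a -> a < x < 2 * PI - a -> cos x < cos a.
Proof.
intros Ha Hx; destruct (Rle_dec x PI).
- apply cos_decreasing_1; lra.
- replace (cos x) with (cos (2 * PI - x)).
  + apply cos_decreasing_1; lra.
  + rewrite cos_minus, cos_2PI, sin_2PI; ring.
Qed.

Lemma vsub_norm (v u b : point) : dot b b = 1 ->
  edist v u = sqrt (dot (vsub v u) b ^ 2 + cross (vsub v u) b ^ 2).
Proof.
intros Hb; unfold edist; f_equal.
transitivity (((fst v - fst u) ^ 2 + (snd v - snd u) ^ 2) * dot b b);
  [rewrite Hb; ring | unfold dot, cross, vsub; simpl; ring].
Qed.

Lemma dot_dir (a b : R) : dot (dir a) (dir b) = cos (a - b).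
Proof. unfold dot, dir; simpl; rewrite cos_minus; ring. Qed.

(** The angle is [b = atan (- l / f)]; the minus sign appears because the cross product with [dir a]
    is negative for vectors counterclockwise of [dir a]. *)
Lemma polar_form (v u : point) (a t : R) :
  Rabs (cross (vsub v u) (dir a)) < tan t * dot (vsub v u) (dir a) ->
  0 < t < PI / 2 ->
  0 < edist v u /\ exists b, - t < b < t /\
    vsub v u = (edist v u * cos (a + b), edist v u * sin (a + b)).
Proof.
intros H Ht2.
set (f := dot (vsub v u) (dir a)) in *; set (l := cross (vsub v u) (dir a)) in *.
assert (Htan : 0 < tan t) by (apply tan_gt_0; lra).
assert (Hf : 0 < f) by (pose proof (Rabs_pos l); nra).
assert (Hl : - tan t < - l / f < tan t).
{ apply Rabs_def2 in H; split.
  - apply Rmult_lt_reg_r with f; [easy|]. unfold Rdiv.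
    rewrite Rmult_assoc, Rinv_l; lra.
  - apply Rmult_lt_reg_r with f; [easy|]. unfold Rdiv.
    rewrite Rmult_assoc, Rinv_l; lra. }
set (b := atan (- l / f)).
assert (Hb : - t < b < t).
{ rewrite <- (atan_tan t) by lra.
  split; [rewrite <- atan_opp|]; apply atan_increasing; lra. }
assert (Hcb : 0 < cos b) by (apply cos_gt_0; lra).
assert (Hsb : sin b = - l / f * cos b).
{ pose proof (tan_atan (- l / f)) as E; fold b in E; unfold tan in E.
  rewrite <- E; field; lra. }
assert (Hbb : dot (dir a) (dir a) = 1)
  by (rewrite dot_dir, Rminus_diag; apply cos_0).
assert (Hd : edist v u * cos b = f).
{ rewrite (vsub_norm v u (dir a) Hbb); fold f l.
  replace (f ^ 2 + l ^ 2) with ((f / cos b) ^ 2).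
  - replace ((f / cos b) ^ 2) with (Rsqr (f / cos b)) by (unfold Rsqr; ring).
    rewrite sqrt_Rsqr; [field; lra|]. apply Rlt_le, Rdiv_lt_0_compat; lra.
  - assert (E : f ^ 2 * (Rsqr (sin b) + Rsqr (cos b)) = (f ^ 2 + l ^ 2) * cos b ^ 2).
    { rewrite Hsb; unfold Rsqr; field; lra. }
    rewrite sin2_cos2, Rmult_1_r in E.
    replace ((f / cos b) ^ 2) with (f ^ 2 / cos b ^ 2) by (field; lra).
    apply Rmult_eq_reg_r with (cos b ^ 2); [|nra].
    rewrite <- E; field; lra. }
assert (Hd' : edist v u * sin b = - l).
{ rewrite Hsb; replace (edist v u * (- l / f * cos b))
    with (edist v u * cos b * (- l / f)) by ring.
  rewrite Hd; field; lra. }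
split; [nra|].
exists b; split; [easy|].
rewrite cos_plus, sin_plus.
(* The vector is recovered from its coordinates [f] and [l] in the frame rotated by [a]. *)
assert (E1 : fst (vsub v u) = f * cos a + l * sin a).
{ transitivity (fst (vsub v u) * (Rsqr (sin a) + Rsqr (cos a)));
    [rewrite sin2_cos2; ring|].
  unfold f, l, dot, cross, dir, vsub, Rsqr; simpl; ring. }
assert (E2 : snd (vsub v u) = f * sin a - l * cos a).
{ transitivity (snd (vsub v u) * (Rsqr (sin a) + Rsqr (cos a)));
    [rewrite sin2_cos2; ring|].
  unfold f, l, dot, cross, dir, vsub, Rsqr; simpl; ring. }
rewrite (surjective_pairing (vsub v u)), E1, E2, <- Hd.
replace l with (- (edist v u * sin b)) by lra.
f_equal; ring.
Qed.

(** The strict slope bound puts [v] in the interior of cone [i], so its angle to every other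
    bisector exceeds [theta m / 2]; points on a shared boundary ray would lie in two cones. *)
Lemma in_cone_of_tan (m i : nat) (u v : point) : (2 < m)%nat ->
  Rabs (cross (vsub v u) (bisector m i)) < tan (theta m / 2) * proj m i u v ->
  in_cone m i u v /\
  forall j, (i < m)%nat -> (j < m)%nat -> in_cone m j u v -> j = i.
Proof.
intros Hm H.
assert (Hth := theta_pos m ltac:(lia)); assert (Hm2 := INR_theta m ltac:(lia)).
pose proof PI_RGT_0 as HPI.
assert (Hm3 : 3 <= INR m) by (replace 3 with (INR 3) by (simpl; lra); apply le_INR; lia).
assert (Ht2 : 0 < theta m / 2 < PI / 2) by nra.
destruct (polar_form v u _ (theta m / 2) H Ht2) as (Hd & b & Hb & E).
assert (Hdot : forall j, dot (vsub v u) (bisector m j)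
          = edist v u * cos (b + (INR j - INR i) * theta m)).
{ intros j; rewrite E.
  transitivity (edist v u * dot (dir (PI / 2 - INR i * theta m + b)) (bisector m j)).
  - unfold dot, dir; simpl; ring.
  - unfold bisector; rewrite dot_dir; f_equal; f_equal; ring. }
split; [split|].
- intros ->; unfold edist in Hd; rewrite !Rminus_diag in Hd.
  replace (0 ^ 2 + 0 ^ 2) with 0 in Hd by ring; rewrite sqrt_0 in Hd; lra.
- rewrite Hdot, Rminus_diag, Rmult_0_l, Rplus_0_r.
  apply Rle_ge, Rmult_le_compat_l; [lra|].
  destruct (Rle_dec 0 b).
  + apply cos_decr_1; lra.
  + rewrite <- (cos_neg b); apply cos_decr_1; lra.
- intros j Hi Hj [_ Hc]; rewrite Hdot in Hc.
  apply Rge_le, Rmult_le_reg_l in Hc; [|easy].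
  (* For [j <> i] the index gap is between 1 and [m - 1]. As [b] is less than half a cone angle in
     absolute value, the total angle stays more than [theta m / 2] away from 0 and from a full
     turn. *)
  destruct (Nat.lt_total j i) as [Hij|[Hij|Hij]]; [exfalso|easy|exfalso].
  + assert (H1 : 1 <= INR i - INR j <= INR m - 1).
    { rewrite <- minus_INR by lia; split; [apply (le_INR 1); lia|].
      replace (INR m - 1) with (INR (m - 1)) by (rewrite minus_INR by lia; simpl; lra).
      apply le_INR; lia. }
    rewrite <- (cos_neg (b + _)) in Hc.
    assert (cos (- (b + (INR j - INR i) * theta m)) < cos (theta m / 2)); [|lra].
    apply cos_lt_away; nra.
  + assert (H1 : 1 <= INR j - INR i <= INR m - 1).
    { rewrite <- minus_INR by lia; split; [apply (le_INR 1); lia|].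
      replace (INR m - 1) with (INR (m - 1)) by (rewrite minus_INR by lia; simpl; lra).
      apply le_INR; lia. }
    assert (cos (b + (INR j - INR i) * theta m) < cos (theta m / 2)); [|lra].
    apply cos_lt_away; nra.
Qed.

(** Only cone [i] of [x] contains [y], so only that cone could create the edge, and there [z] has a
    smaller projection. *)
Lemma not_theta_edge_of_blocker (m i : nat) (P : list point) (x y z : point) :
  (2 < m)%nat -> (i < m)%nat -> In z P ->
  Rabs (cross (vsub y x) (bisector m i)) < tan (theta m / 2) * proj m i x y ->
  Rabs (cross (vsub z x) (bisector m i)) < tan (theta m / 2) * proj m i x z ->
  proj m i x z < proj m i x y ->
  ~ theta_edge m P x y.
Proof.
intros Hm Hi Hz Hy Hzc Hlt (_ & _ & j & Hj & Hin & Hmin).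
destruct (in_cone_of_tan m i x y Hm Hy) as [_ Hu].
destruct (in_cone_of_tan m i x z Hm Hzc) as [Hzi _].
assert (j = i) by (apply Hu; easy); subst j.
specialize (Hmin z Hz Hzi); lra.
Qed.

(** * The twelve-site configuration and its potential *)

Inductive compass := North | East | South | West.

Definition axis (d : compass) : point :=
  match d with
  | North => (0, 1) | East => (1, 0) | South => (0, -1) | West => (-1, 0)
  end.

Definition axis_cone (k : nat) (d : compass) : nat :=
  match d with
  | North => 0 | East => k + 1 | South => 2 * (k + 1) | West => 3 * (k + 1)
  end.

(** A quarter turn consists of exactly [k + 1] cones. *)
Lemma bisector_axis_cone (k : nat) (d : compass) :
  bisector (4 * k + 4) (axis_cone k d) = axis d.
Proof.
assert (E : INR (k + 1) * theta (4 * k + 4) = PI / 2).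
{ pose proof (INR_theta (4 * k + 4) ltac:(lia)) as H.
  replace (4 * k + 4)%nat with (4 * (k + 1))%nat in H at 1 by lia.
  rewrite mult_INR in H; simpl (INR 4) in H; lra. }
unfold bisector, dir; destruct d; unfold axis_cone, axis.
- simpl (INR 0); rewrite Rmult_0_l, Rminus_0_r, cos_PI2, sin_PI2; easy.
- rewrite E, Rminus_diag, cos_0, sin_0; easy.
- rewrite mult_INR, Rmult_assoc, E; simpl (INR 2).
  replace (PI / 2 - (1 + 1) * (PI / 2)) with (- (PI / 2)) by field.
  rewrite cos_neg, sin_neg, cos_PI2, sin_PI2; easy.
- rewrite mult_INR, Rmult_assoc, E; simpl (INR 3).
  replace (PI / 2 - (1 + 1 + 1) * (PI / 2)) with (- PI) by field.
  rewrite cos_neg, sin_neg, cos_PI, sin_PI, Ropp_0; easy.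
Qed.

(* U0 = u and W0 = w; the letters U, D, A, W stand for the clusters at the lower left,
   lower right, upper left and upper right of the configuration.  The central symmetry
   exchanges Ui with Wi and Ai with Di. *)
Inductive site := U0 | U1 | U2 | A0 | A1 | A2 | D0 | D1 | D2 | W0 | W1 | W2.

Definition site_eq_dec (x y : site) : {x = y} + {x <> y}.
Proof. decide equality. Defined.

Definition sites : list site := [U0; U1; U2; A0; A1; A2; D0; D1; D2; W0; W1; W2].

Lemma in_sites (x : site) : In x sites.
Proof. destruct x; simpl; tauto. Qed.

Lemma NoDup_sites : NoDup sites.
Proof. repeat constructor; simpl; intuition discriminate. Qed.

(** [W1] is where the boundaries of the north cone of [W0] and the south cone of [W2] meet. The
    central symmetry is [(a, b) -> (t - a, 1 - b)]. *)
Definition ideal (t : R) (x : site) : point :=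
  match x with
  | U0 => (0, 0)
  | U1 => (- t ^ 3, - t ^ 2)
  | U2 => (0, - 2 * t ^ 2)
  | A0 => (- t, 1)
  | A1 => (- t - t ^ 3, 1 + t ^ 2)
  | A2 => (- t, 1 + 2 * t ^ 2)
  | D0 => (2 * t, 0)
  | D1 => (2 * t + t ^ 3, - t ^ 2)
  | D2 => (2 * t, - 2 * t ^ 2)
  | W0 => (t, 1)
  | W1 => (t + t ^ 3, 1 + t ^ 2)
  | W2 => (t, 1 + 2 * t ^ 2)
  end.

(* The multiples of h are chosen so that each cone membership and each comparison of
   projections used by [blocker] holds with margin h for all t <= 1/2. *)
Definition shift (x : site) : point :=
  match x with
  | U0 => (0, 0)
  | U1 => (4, 3)
  | U2 => (1, 6)
  | A0 => (2, -2)
  | A1 => (6, -5)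
  | A2 => (3, -8)
  | D0 => (-4, 2)
  | D1 => (-8, 5)
  | D2 => (-5, 8)
  | W0 => (-2, 0)
  | W1 => (-6, -3)
  | W2 => (-3, -6)
  end.

Definition shifted (t h : R) (x : site) : point :=
  (fst (ideal t x) + h * fst (shift x), snd (ideal t x) + h * snd (shift x)).

(* In units of |uw| = sqrt (1 + t^2). *)
Definition pot (t : R) (x : site) : R :=
  match x with
  | U0 => 0
  | U1 => t ^ 2
  | U2 => 2 * t ^ 2
  | A0 => 1
  | A1 => 1 + t ^ 2
  | A2 => 1 + 2 * t ^ 2
  | D0 => 2 * t + 2 * t ^ 2
  | D1 => 2 * t + t ^ 2
  | D2 => 2 * t
  | W0 => 1 + 2 * t + 2 * t ^ 2
  | W1 => 1 + 2 * t + t ^ 2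
  | W2 => 1 + 2 * t
  end.

(* [Some (d, z)] when y lies in the cone with axis d of x and z is a closer point of
   that cone, so that x has no edge to y. *)
Definition blocker (x y : site) : option (compass * site) :=
  match x, y with
  | A0, A2 => Some (North, A1) | A2, A0 => Some (South, A1)
  | W0, W2 => Some (North, W1) | W2, W0 => Some (South, W1)
  | U0, U2 => Some (South, U1) | U2, U0 => Some (North, U1)
  | D0, D2 => Some (South, D1) | D2, D0 => Some (North, D1)
  | A0, W0 | A0, W1 | A1, W0 => Some (East, W2)
  | W0, A0 | W0, A1 | W1, A0 => Some (West, A2)
  | U0, D0 | U0, D1 | U1, D0 => Some (East, D2)
  | D0, U0 | D0, U1 | D1, U0 => Some (West, U2)
  | U0, A2 | U0, W0 | U0, W1 | U0, W2 => Some (North, A0)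
  | U1, W0 | U1, W1 | U1, W2 | U2, W0 | U2, W1 | U2, W2 => Some (North, U0)
  | A2, U0 => Some (South, A1)
  | W0, U0 | W0, U1 | W0, U2 | W0, D2 => Some (South, D0)
  | W1, U0 | W1, U1 | W1, U2 | W2, U0 | W2, U1 | W2, U2 => Some (South, W0)
  | D2, W0 => Some (North, D1)
  | _, _ => None
  end.

(** The slack [mu] is the margin that the later generic perturbation may consume. *)
Definition ahead (t mu : R) (d : compass) (p q : point) : Prop :=
  Rabs (cross (vsub q p) (axis d)) + mu <= t * dot (vsub q p) (axis d).

Lemma blocker_spec (t h : R) (x y z : site) (d : compass) :
  0 < t <= 1 / 2 -> 0 < h -> 100 * h <= t ^ 3 -> blocker x y = Some (d, z) ->
  ahead t h d (shifted t h x) (shifted t h y) /\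
  ahead t h d (shifted t h x) (shifted t h z) /\
  dot (vsub (shifted t h z) (shifted t h x)) (axis d) + h
    <= dot (vsub (shifted t h y) (shifted t h x)) (axis d).
Proof.
intros Ht Hh Hht.
assert (H2 : 0 < t ^ 2 <= t / 2) by nra.
assert (H3 : 0 < t ^ 3 <= t ^ 2 / 2) by nra.
assert (H4 : 0 < t ^ 4 <= t ^ 3 / 2) by nra.
assert (Hth : 0 < t * h <= h / 2) by nra.
assert (Habs : forall a b c : R, a + b <= c -> - a + b <= c -> Rabs a + b <= c).
{ intros a b c; unfold Rabs; destruct (Rcase_abs a); lra. }
(* Every case is linear in [h], [t * h] and the powers of [t], so the bounds above on these
   monomials suffice. *)
destruct x, y; simpl blocker; intros E; try discriminate E;
  injection E as <- <-; repeat split;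
  try apply Habs; unfold cross, dot, vsub, shifted, axis, ideal, shift, fst, snd;
  lra.
Qed.

(** Any two sites differ by at least [t ^ 2] in some coordinate. This turns an absolute perturbation
    error into a relative one. *)
Lemma ideal_separated (t : R) (x y : site) : 0 < t <= 1 / 2 -> x <> y ->
  (t ^ 2) ^ 2 <= (fst (ideal t x) - fst (ideal t y)) ^ 2
             + (snd (ideal t x) - snd (ideal t y)) ^ 2.
Proof.
intros Ht Hxy.
assert (H2 : 0 < t ^ 2 <= t / 2) by nra.
assert (H3 : 0 < t ^ 3 <= t ^ 2 / 2) by nra.
assert (Hsq : forall a b c : R, 0 <= c -> c <= a \/ c <= - a \/ c <= b \/ c <= - b ->
          c ^ 2 <= a ^ 2 + b ^ 2).
{ intros a b c Hc [H|[H|[H|H]]]; nra. }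
apply Hsq; [lra|].
destruct x, y; try congruence; unfold ideal, fst, snd;
 first [left; lra | right; left; lra | right; right; left; lra | right; right; right; lra].
Qed.

(** The squared form, with [1 + t ^ 2] the square of the unit |uw|, is polynomial in [t] and linear
    in its powers up to the sixth. It is an equality on the pair [A0], [W2], for instance. *)
Lemma pot_lipschitz (t : R) (x y : site) : 0 < t <= 1 / 2 ->
  blocker x y = None ->
  (1 + t ^ 2) * (pot t x - pot t y) ^ 2
    <= (fst (ideal t x) - fst (ideal t y)) ^ 2
     + (snd (ideal t x) - snd (ideal t y)) ^ 2.
Proof.
intros Ht.
assert (H2 : 0 < t ^ 2 <= t / 2) by nra.
assert (H3 : 0 < t ^ 3 <= t ^ 2 / 2) by nra.
assert (H4 : 0 < t ^ 4 <= t ^ 3 / 2) by nra.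
assert (H5 : 0 < t ^ 5 <= t ^ 4 / 2) by nra.
assert (H6 : 0 < t ^ 6 <= t ^ 5 / 2) by nra.
destruct x, y; simpl blocker; intros E; try discriminate E; clear E;
  unfold ideal, pot, fst, snd; lra.
Qed.

(** * Stability of distances and cone conditions under perturbation *)

Lemma shifted_near_ideal (t h : R) (x : site) :
  0 < h -> near (9 * h) (ideal t x) (shifted t h x).
Proof. intros Hh; destruct x; unfold near, shifted, shift; simpl; lra. Qed.

Lemma near_sym (e : R) (p q : point) : near e p q -> near e q p.
Proof. unfold near; lra. Qed.

Lemma near_trans (e e' : R) (p q r : point) :
  near e p q -> near e' q r -> near (e + e') p r.
Proof. unfold near; lra. Qed.

Lemma edist_near (e : R) (p q p' q' : point) :
  near e p q -> near e p' q' -> edist p p' <= edist q q' + 4 * e.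
Proof.
unfold near; intros [H1 H2] [H3 H4]; unfold edist.
set (a := fst p - fst p'); set (b := snd p - snd p').
set (a' := fst q - fst q'); set (b' := snd q - snd q').
set (S := sqrt (a' ^ 2 + b' ^ 2)).
assert (HS : S * S = a' ^ 2 + b' ^ 2) by (apply sqrt_sqrt; nra).
assert (HS0 : 0 <= S) by apply sqrt_pos.
assert (Ha : - S <= a' <= S) by (split; nra).
assert (Hb : - S <= b' <= S) by (split; nra).
assert (Haa : - (2 * e) <= a - a' <= 2 * e) by (unfold a, a'; lra).
assert (Hbb : - (2 * e) <= b - b' <= 2 * e) by (unfold b, b'; lra).
rewrite <- (sqrt_Rsqr (S + 4 * e)) by lra.
apply sqrt_le_1_alt; unfold Rsqr.
replace a with (a' + (a - a')) by ring; replace b with (b' + (b - b')) by ring.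
generalize dependent (a - a'); generalize dependent (b - b'); intros y Hy x Hx.
(* The cross terms add at most [8 * e * S] and the squares at most [8 * e ^ 2], which fits below
   [(S + 4 * e) ^ 2]. *)
assert (a' * x <= S * (2 * e)) by nra.
assert (b' * y <= S * (2 * e)) by nra.
nra.
Qed.

(** Both products move by at most [h / 2], which costs at most [h / 2 + t * h / 2 <= 3 * h / 4] of
    the margin [h]. *)
Lemma ahead_near (t h : R) (d : compass) (p q p' q' : point) :
  0 < t <= 1 / 2 -> 0 < h -> near (h / 4) p q -> near (h / 4) p' q' ->
  ahead t h d p p' ->
  Rabs (cross (vsub q' q) (axis d)) < t * dot (vsub q' q) (axis d).
Proof.
intros Ht Hh [H1 H2] [H3 H4] Ha; unfold ahead in Ha.
assert (Hc : Rabs (cross (vsub q' q) (axis d) - cross (vsub p' p) (axis d)) <= h / 2).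
{ apply Rabs_le; destruct d; unfold cross, vsub, axis, fst, snd in *; lra. }
assert (Hd : - (h / 2) <= dot (vsub q' q) (axis d) - dot (vsub p' p) (axis d)).
{ destruct d; unfold dot, vsub, axis, fst, snd in *; lra. }
pose proof (Rabs_triang_inv (cross (vsub q' q) (axis d)) (cross (vsub p' p) (axis d))).
nra.
Qed.

Lemma dot_axis_near (e : R) (d : compass) (p q x y z w : point) :
  near e p q -> near e x y -> near e z w ->
  dot (vsub w q) (axis d) - dot (vsub y q) (axis d)
    < dot (vsub z p) (axis d) - dot (vsub x p) (axis d) + 2 * e.
Proof.
intros [H1 H2] [H3 H4] [H5 H6];
  destruct d; unfold dot, vsub, axis, fst, snd in *; lra.
Qed.

(** With at least 8 cones, [theta] is at most [PI / 4], so its sine is at most its cosine. The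
    double-angle formulas then give [t * (t + 2) <= 1]. *)
Lemma tan_half_theta_bounds (k : nat) : (1 <= k)%nat ->
  0 < tan (theta (4 * k + 4) / 2) <= 1 / 2.
Proof.
intros Hk; set (m := (4 * k + 4)%nat).
assert (Hm2 := INR_theta m ltac:(lia)); assert (Hth := theta_pos m ltac:(lia)).
assert (Hm3 : 8 <= INR m) by (replace 8 with (INR 8) by (simpl; lra); apply le_INR; lia).
pose proof PI_RGT_0.
assert (Hx : theta m <= PI / 4).
{ assert (0 <= (INR m - 8) * theta m) by (apply Rmult_le_pos; lra). lra. }
set (x := theta m / 2) in *.
assert (Hs : 0 < sin x) by (apply sin_gt_0; unfold x; lra).
assert (Hc : 0 < cos x) by (apply cos_gt_0; unfold x; lra).
assert (Ht : 0 < tan x) by (apply tan_gt_0; unfold x; lra).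
split; [easy|].
assert (E : sin (theta m) <= cos (theta m)).
{ rewrite <- sin_shift; apply sin_incr_1; lra. }
replace (theta m) with (2 * x) in E by (unfold x; field).
rewrite sin_2a, cos_2a in E.
assert (Hts : sin x = tan x * cos x) by (unfold tan; field; lra).
rewrite Hts in E.
assert (Hcc : 0 < cos x * cos x) by nra.
assert (tan x * (tan x + 2) <= 1);
  [|generalize dependent (tan x); clear; intros; nra].
apply Rmult_le_reg_l with (cos x * cos x); lra.
Qed.

(** * Choice of parameters and the final estimate *)

Theorem mainTheorem16 :
  forall (k : nat), (1 <= k)%nat ->
  forall eps : R, eps > 0 ->
  exists (P : list point) (u w : point),
    NoDup P /\ general_position (4 * k + 4) P /\
    In u P /\ In w P /\ u <> w /\
    forall L, theta_path (4 * k + 4) P u w L ->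
      L >= (1 + 2 * tan (theta (4 * k + 4) / 2)
              + 2 * (tan (theta (4 * k + 4) / 2)) ^ 2 - eps) * edist u w.
Proof.
intros k Hk eps Heps.
assert (Ht := tan_half_theta_bounds k Hk).
set (t := tan (theta (4 * k + 4) / 2)) in *.
(* [lam] is the relative loss granted to the potential. *)
set (lam := Rmin eps 1 / 12).
assert (Hlam : 0 < lam /\ 12 * lam <= eps /\ 12 * lam <= 1).
{ unfold lam; pose proof (Rmin_l eps 1); pose proof (Rmin_r eps 1).
  assert (0 < Rmin eps 1) by (apply Rmin_glb_lt; lra). lra. }
assert (H2 : 0 < t ^ 2 <= t / 2) by nra.
assert (H3 : 0 < t ^ 3 <= t ^ 2 / 2) by nra.
(* Sites end up within [10 * h] of their ideal positions, so distances change by at most [40 * h],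
   at most [lam] times the least ideal distance [t ^ 2]. *)
set (h := lam * t ^ 3 / 100).
assert (Hh : 0 < h) by (unfold h; nra).
assert (Hht : 100 * h <= t ^ 3) by (unfold h; nra).
assert (Hhl : 40 * h <= lam * t ^ 2) by (unfold h; nra).
destruct (general_position_approx site site_eq_dec (4 * k + 4) sites (shifted t h) (h / 4))
  as (p & Hnear & Hdist & Hgp); [lia|lra|apply NoDup_sites|].
assert (Hnear' : forall x, near (10 * h) (ideal t x) (p x)).
{ intros x; apply near_le with (9 * h + h / 4); [lra|].
  eapply near_trans; [now apply shifted_near_ideal|apply Hnear, in_sites]. }
set (r := sqrt (1 + t ^ 2)).
assert (Hrr : r * r = 1 + t ^ 2) by (apply sqrt_sqrt; lra).
assert (Hr0 : 0 <= r) by apply sqrt_pos.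
assert (Hr : 1 <= r) by nra.
assert (Hedge : forall x y, theta_edge (4 * k + 4) (map p sites) (p x) (p y) ->
          Rabs ((1 - lam) * r * pot t x - (1 - lam) * r * pot t y) <= edist (p x) (p y)).
{ intros x y He.
  destruct (site_eq_dec x y) as [<-|Hxy].
  { rewrite Rminus_diag, Rabs_R0; apply sqrt_pos. }
  destruct (blocker x y) as [[d z]|] eqn:Hb.
  - exfalso; revert He.
    destruct (blocker_spec t h x y z d Ht Hh Hht Hb) as (Hy & Hz & Hlt).
    pose proof (Hnear x (in_sites x)) as Nx.
    pose proof (Hnear y (in_sites y)) as Ny.
    pose proof (Hnear z (in_sites z)) as Nz.
    apply (not_theta_edge_of_blocker _ (axis_cone k d) _ _ _ (p z)); unfold proj;
      rewrite ?bisector_axis_cone; fold t.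
    + lia.
    + destruct d; simpl; lia.
    + apply in_map, in_sites.
    + eapply ahead_near; eassumption.
    + eapply ahead_near; eassumption.
    + pose proof (dot_axis_near _ d _ _ _ _ _ _ Nx Ny Nz); lra.
  (* Without a blocker, the actual distance is at least [1 - lam] times the ideal one, matching the
     scaled potential. *)
  - pose proof (pot_lipschitz t x y Ht Hb) as Hlip.
    pose proof (ideal_separated t x y Ht Hxy) as Hsep.
    pose proof (edist_near _ _ _ _ _ (Hnear' x) (Hnear' y)) as Hd.
    assert (H0 : t ^ 2 <= edist (ideal t x) (ideal t y)).
    { unfold edist; rewrite <- (sqrt_pow2 (t ^ 2)) by lra; now apply sqrt_le_1_alt. }
    assert (H1 : r * Rabs (pot t x - pot t y) <= edist (ideal t x) (ideal t y)).
    { pose proof (Rabs_pos (pot t x - pot t y)).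
      unfold edist; rewrite <- (sqrt_pow2 (r * _)) by nra.
      apply sqrt_le_1_alt; rewrite Rpow_mult_distr, pow2_abs.
      replace (r ^ 2) with (1 + t ^ 2) by (rewrite <- Hrr; ring); easy. }
    replace (_ - _) with ((1 - lam) * (r * (pot t x - pot t y))) by ring.
    rewrite !Rabs_mult, (Rabs_pos_eq (1 - lam)), (Rabs_pos_eq r) by lra.
    nra. }
exists (map p sites), (p U0), (p W0); repeat split; try easy; try apply Hgp;
  try apply in_map, in_sites.
- intros E; enough (U0 = W0) by discriminate.
  apply (NoDup_map_inj _ _ p sites); auto using in_sites.
- intros L HL.
  pose proof (path_length_ge_potential _ _ _ _ (fun x => (1 - lam) * r * pot t x) Hdist
    (fun x y _ _ => Hedge x y) _ _ _ HL U0 W0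
    (in_sites _) (in_sites _) eq_refl eq_refl) as Hlen.
  pose proof (edist_near _ _ _ _ _ (near_sym _ _ _ (Hnear' U0)) (near_sym _ _ _ (Hnear' W0)))
    as Hd.
  assert (Hi : edist (ideal t U0) (ideal t W0) = r).
  { unfold edist, r; simpl; f_equal; ring. }
  rewrite Hi in Hd.
  assert (Hpos : 0 <= edist (p U0) (p W0)) by apply sqrt_pos.
  set (Phi := 1 + 2 * t + 2 * t ^ 2) in *.
  assert (HPhi : 1 <= Phi <= 3) by (unfold Phi; lra).
  cbv beta in Hlen; change (pot t W0) with Phi in Hlen; change (pot t U0) with 0 in Hlen.
  rewrite Rmult_0_r, Rminus_0_r in Hlen.
  clearbody Phi.
  apply Rle_ge; eapply Rle_trans; [|exact Hlen].
  (* A nonpositive factor is trivial. Otherwise |uw| is at most [r + lam * t ^ 2], and the total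
     loss is at most [3 * lam + 3 * lam * r <= 6 * lam * r], which [eps * r] covers. *)
  destruct (Rle_dec (Phi - eps) 0) as [Hn|Hn].
  + apply Rle_trans with 0.
    * rewrite <- (Rmult_0_l (edist (p U0) (p W0))); now apply Rmult_le_compat_r.
    * repeat apply Rmult_le_pos; lra.
  + apply Rle_trans with ((Phi - eps) * (r + lam * t ^ 2)).
    { apply Rmult_le_compat_l; lra. }
    assert (Hll : lam * t ^ 2 <= lam * 1) by (apply Rmult_le_compat_l; lra).
    assert (0 < lam * t ^ 2) by (apply Rmult_lt_0_compat; lra).
    assert (Phi * (lam * t ^ 2) <= 3 * (lam * 1)) by (apply Rmult_le_compat; lra).
    assert (0 < eps * (lam * t ^ 2)) by (apply Rmult_lt_0_compat; lra).
    assert (lam * r * Phi <= lam * r * 3)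
      by (apply Rmult_le_compat_l; [apply Rmult_le_pos|]; lra).
    assert (12 * lam * r <= eps * r) by (apply Rmult_le_compat_r; lra).
    assert (lam * 1 <= lam * r) by (apply Rmult_le_compat_l; lra).
    lra.
Qed.
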